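(* For fixed sample $M$ of $m$ users, the Optimal Bernoulli Density Estimator provides an unbiased estimate $\tilde d$ of the density $d(\mathcal{S}_M)$ of $\mathcal{S}_M$ and has mean squared error $$\mathbb{E}\bigl[(\tilde d-d(\mathcal{S}_M))^2\bigr]\le\frac1{4m\tanh^2(\frac\varepsilon2)}+\frac2{m^2\varepsilon^2}.$$
   Context: Streams: $\mathcal{U}$ is a finite universe of users; a data stream is a finite sequence $\mathcal{S}=(s_1,\dots,s_T)$ with $s_t\in\mathcal{U}$. For a set $M\subseteq\mathcal{U}$ of $m$ users, $\mathcal{S}_M$ is the subsequence of $\mathcal{S}$ consisting of the updates $s_t\in M$, and its density $d(\mathcal{S}_M)$ is the fraction of the $m$ users of $M$ that appear in it (at least once). Optimal Bernoulli Density Estimator (privacy parameter $0<\varepsilon\le\frac12$, sample size $m$): sample a random subset $M\subseteq\mathcal{U}$ of $m$ users without replacement, ordered as $M[1],\dots,M[m]$; keep a bit array $\mathbf{b}=[b_1\ \dots\ b_m]$, with entries initialized independently as $b_i\sim\mathrm{Bernoulli}\bigl(\frac12(1-\tanh\frac\varepsilon2)\bigr)$. For $t=1,\dots,T$: if $s_t=M[i]$ for some $i$, re-sample $b_i\sim\mathrm{Bernoulli}\bigl(\frac12(1+\tanh\frac\varepsilon2)\bigr)$ (with fresh randomness). At the end output $$\tilde d=\frac1{\tanh(\varepsilon/2)}\Bigl(\frac1m\sum_{i=1}^m b_i-\frac12+\frac12\tanh\frac\varepsilon2\Bigr)+\mathrm{Laplace}\bigl(0,\tfrac1{\varepsilon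 m}\bigr),$$ where $\mathrm{Laplace}(0,s)$ denotes an independent random variable with density $\frac1{2s}e^{-|x|/s}$. The expectation is over the bits and the Laplace noise, with $\mathcal{S}$ and $M$ fixed. *)

(* Defs.v *)
From HB Require Import structures.
From mathcomp Require Import all_boot all_order all_algebra.
From mathcomp Require Import all_classical all_reals all_analysis.
Set Implicit Arguments.
Unset Strict Implicit.
Unset Printing Implicit Defensive.
Import Order.TTheory GRing.Theory Num.Theory.
Import numFieldNormedType.Exports.
Local Open Scope classical_set_scope.
Local Open Scope ring_scope.

Definition tanh (R : realType) (x : R) : R :=
  (expR x - expR (- x)) / (expR x + expR (- x)).

Definition laplace_pdf (R : realType) (s x : R) : R :=
  (2 * s)^-1 * expR (- `|x| / s).

(* Mutual independence of a finite family of set systems; applied below to the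
   sigma-algebras generated by random variables, whose codomains may differ. *)
Definition mutually_independent (d : measure_display) (Omega : measurableType d)
    (R : realType) (P : probability Omega R) (I : finType)
    (F : I -> set (set Omega)) : Prop :=
  forall (J : {set I}) (A : I -> set Omega),
    (forall i, i \in J -> F i (A i)) ->
    P (\bigcap_(i in [set` J]) A i) = (\prod_(i in J) P (A i))%E.

Section Stream.
Variable U : finType.

Definition substream (M S : seq U) : seq U := [seq u <- S | u \in M].

Definition density (R : realType) (M S : seq U) : R :=
  #|[set u in M | u \in substream M S]%SET|%:R / #|[set u in M]%SET|%:R.

End Stream.

Section Estimator.
Variables (U : finType) (m T : nat) (M : m.-tuple U) (S : T.-tuple U).

(* One update [s] of the stream, [r] being the fresh bit available to it: [r]
   is used only if [s] is in the sample. *)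
Definition obde_step (b : {ffun 'I_m -> bool}) (sr : U * bool) :
    {ffun 'I_m -> bool} :=
  [ffun i => if sr.1 == tnth M i then sr.2 else b i].

Definition obde_bits (b0 : 'I_m -> bool) (r : 'I_T -> bool) :
    {ffun 'I_m -> bool} :=
  foldl obde_step [ffun i => b0 i] [seq (tnth S t, r t) | t <- enum 'I_T].

Definition obde_output (R : realType) (eps : R) (b0 : 'I_m -> bool)
    (r : 'I_T -> bool) (z : R) : R :=
  (tanh (eps / 2))^-1 *
    (m%:R^-1 * (\sum_(i < m) (obde_bits b0 r i)%:R)
       - 1 / 2 + 1 / 2 * tanh (eps / 2)) + z.

End Estimator.

(* The random inputs of the estimator: the initial bits, one fresh bit per
   update of the stream, and the Laplace noise of scale 1 / (eps * m). *)
Record obde_randomness (d : measure_display) (Omega : measurableType d)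
    (R : realType) (P : probability Omega R) (eps : R) (m T : nat) := {
  init_bit : 'I_m -> {RV P >-> bool};
  fresh_bit : 'I_T -> {RV P >-> bool};
  noise : {RV P >-> R};
  init_bit_law : forall (i : 'I_m) (A : set bool),
    distribution P (init_bit i) A =
      bernoulli_prob (1 / 2 * (1 - tanh (eps / 2))) A;
  fresh_bit_law : forall (t : 'I_T) (A : set bool),
    distribution P (fresh_bit t) A =
      bernoulli_prob (1 / 2 * (1 + tanh (eps / 2))) A;
  noise_law : forall A : set R, measurable A ->
    distribution P noise A =
      (\int[lebesgue_measure]_(x in A)
         (laplace_pdf (1 / (eps * m%:R)) x)%:E)%E;
  obde_independence :
    mutually_independent P (fun k : 'I_m + 'I_T + unit =>
      match k with
      | inl (inl i) => g_sigma_algebra_preimage (init_bit i)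
      | inl (inr t) => g_sigma_algebra_preimage (fresh_bit t)
      | inr tt => g_sigma_algebra_preimage noise
      end)
}.

Definition obde (U : finType) (m T : nat) (M : m.-tuple U) (S : T.-tuple U)
    (d : measure_display) (Omega : measurableType d) (R : realType)
    (P : probability Omega R) (eps : R) (W : obde_randomness P eps m T)
    (w : Omega) : R :=
  obde_output M S eps (fun i => init_bit W i w) (fun t => fresh_bit W t w)
    (noise W w).

(* Main.v *)
(* When the stream ends, the bit of a sampled user is the fresh bit of that
   user's last update, or the initial bit if there is none. Distinct users thus
   read distinct, hence independent, random bits, with mean
   (1 - tanh (eps / 2)) / 2 for absent users and (1 + tanh (eps / 2)) / 2 for
   present ones, and the affine debiasing turns the average of these means into
   the density. The estimator is therefore a scaled sum of pairwise uncorrelated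
   bits plus an uncorrelated centred Laplace variable. Its mean squared error is
   its variance, where each bit contributes at most 1/4 and the noise of scale s
   contributes 2 s^2. *)
Require Import Defs.
From HB Require Import structures.
From mathcomp Require Import all_boot all_order all_algebra.
From mathcomp Require Import ring lra.
From mathcomp Require Import all_classical all_reals all_analysis.
From mathcomp Require Import measurable_realfun.
Import Order.TTheory GRing.Theory Num.Theory.
Import numFieldNormedType.Exports.
Local Open Scope classical_set_scope.
Local Open Scope ring_scope.

Import HBNNSimple.

(** * Change of measure by a density *)

(** Monotone convergence on both sides reduces [f] to its simple approximations [h n]. These are
    finite combinations of indicators of level sets, for which the hypothesis on [nu] is the
    claim. *)
Lemma ge0_integral_density {d} {T : measurableType d} {R : realType}
    (mu nu : {measure set T -> \bar R}) (g : T -> R) (f : T -> \bar R) :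
  measurable_fun setT g -> (forall x, 0 <= g x) ->
  (forall A, measurable A -> nu A = \int[mu]_(x in A) (g x)%:E)%E ->
  measurable_fun [set: T] f -> (forall x, 0 <= f x)%E ->
  (\int[nu]_x f x = \int[mu]_x (f x * (g x)%:E))%E.
Proof.
move=> mg g0 nuE mf f0.
have mT := @measurableT _ T.
pose h := nnsfun_approx mT mf.
have hf x : (EFin (h n x) @[n --> \oo] --> f x)%E.
  exact: cvg_nnsfun_approx.
have h0 n x : (0 <= (h n x)%:E)%E by rewrite lee_fin.
have mh n : measurable_fun setT (EFin \o h n) by exact/measurable_EFinP.
have mgE : measurable_fun setT (EFin \o g) by exact/measurable_EFinP.
have hnd x : {homo (fun n => (h n x)%:E) : a b / (a <= b)%N >-> (a <= b)%E}.
  by move=> a b ab; rewrite lee_fin; exact/lefP/nd_nnsfun_approx.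
transitivity (limn (fun n => \int[nu]_x (h n x)%:E)%E).
  rewrite -monotone_convergence//.
  by apply: eq_integral => x _; apply/esym/cvg_lim => //; exact: hf.
transitivity (limn (fun n => \int[mu]_x ((h n x)%:E * (g x)%:E))%E); last first.
  rewrite -monotone_convergence//.
  - by apply: eq_integral => x _; apply/cvg_lim => //; apply: cvgeZr => //; exact: hf.
  - by move=> n; exact: (emeasurable_funM (mh n) mgE).
  - by move=> n x _; rewrite mule_ge0// lee_fin.
  - by move=> x _ a b ab; rewrite lee_wpmul2r ?lee_fin//; exact/lefP/nd_nnsfun_approx.
congr (limn _); apply/funext => n.
have mi r : measurable (h n @^-1` [set r]) by [].
have msum r : measurable_fun setT (fun x => (r * \1_(h n @^-1` [set r]) x)%:E).
  by apply/measurable_EFinP; exact: measurable_funM.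
have msum0 r t : (0 <= (r * \1_(h n @^-1` [set r]) t)%:E)%E.
  by rewrite EFinM nnfun_muleindic_ge0.
(* With [n] fixed, both integrals are expanded over the level sets of [h n] and compared value by
   value. *)
transitivity (\int[nu]_x (\sum_(y \in range (h n))
    (y * \1_(h n @^-1` [set y]) x)%:E))%E.
  by apply: eq_integral => t _; rewrite /= fimfunE -fsumEFin.
rewrite ge0_integral_fsum//.
transitivity (\int[mu]_x (\sum_(y \in range (h n))
    (y * \1_(h n @^-1` [set y]) x)%:E * (g x)%:E))%E; last first.
  apply: eq_integral => x _; rewrite -ge0_mule_fsuml//.
  by rewrite fsumEFin// -(fimfunE _ x).
rewrite ge0_integral_fsum//; last 2 first.
  - by move=> y; exact: (emeasurable_funM (msum y) mgE).
  - by move=> y x _; rewrite mule_ge0 ?lee_fin//; exact: msum0.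
apply: eq_fsbigr => r rhn.
under eq_integral do rewrite EFinM.
rewrite integralZl_indic_nnsfun => //.
under [RHS]eq_integral do rewrite EFinM -muleA.
have r0 : 0 <= r by move: rhn => /[!inE] -[x _ <-].
rewrite [RHS]ge0_integralZl//=.
- rewrite integral_indic// setIT nuE// integral_mkcond; congr (_ * _)%E.
  by apply: eq_integral => x _; rewrite epatch_indic/= muleC.
- by apply: (emeasurable_funM _ mgE); exact/measurable_EFinP.
- by move=> x _; rewrite mule_ge0 ?lee_fin//; exact: msum0.
Qed.

(** * Integrals over the whole line and decay at infinity *)

Lemma ge0_integralT_fold {R : realType} (f : R -> R) :
  (forall x, 0 <= f x) -> continuous f ->
  (\int[lebesgue_measure]_x (f x)%:E =
   \int[lebesgue_measure]_(x in `[0%R, +oo[) (f x)%:E +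
   \int[lebesgue_measure]_(x in `[0%R, +oo[) (f (- x))%:E)%E.
Proof.
move=> f0 cf.
have mf : measurable_fun [set: R] f by exact: continuous_measurable_fun.
rewrite -(setUv `[0%R, +oo[%classic) ge0_integral_setU//= ; last 4 first.
- exact: measurableC.
- by apply/measurable_EFinP; rewrite setUv.
- by move=> x _; rewrite lee_fin.
- exact/disj_setPCl.
congr (_ + _)%E; rewrite setCitvr.
(* The negative half-line is open at 0. Adding that null endpoint gives the closed interval that the
   substitution of [- x] for [x] expects. *)
rewrite integral_itv_bndo_bndc; last exact/measurable_EFinP/measurable_funTS.
rewrite -{1}oppr0 ge0_integration_by_substitutionNy//.
exact: continuous_subspaceT.
Qed.

Lemma cvgr_invy {R : realType} : x^-1 @[x --> +oo%R] --> (0 : R).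
Proof.
apply/(@gtr0_cvgV0 _ _ _ _ (fun x : R => x)) => //.
by near=> x; near: x; apply: nbhs_pinfty_gt; rewrite num_real.
Unshelve. all: by end_near. Qed.

(** The cubic term of the exponential series gives [expR (- x) <= 3! / x ^+ 3], and for [1 <= x] the
    polynomial is at most a constant times [x ^+ 2], so the product is squeezed by a multiple of
    [x^-1]. *)
Lemma cvg_poly2_expRN {R : realType} (a b c : R) :
  (fun x => (a * x ^+ 2 + b * x + c) * expR (- x)) x @[x --> +oo%R] --> (0 : R).
Proof.
apply: (@squeeze_cvgr _ _ _ _ (fun x => - (6 * (`|a| + `|b| + `|c|)) * x^-1)
  (fun x => 6 * (`|a| + `|b| + `|c|) * x^-1)).
- near=> x.
  have x1 : 1 <= x by near: x; apply: nbhs_pinfty_ge; rewrite num_real.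
  have x0 : 0 < x by lra.
  have e0 := expR_gt0 (- x).
  have ex : expR (- x) <= 6 / x ^+ 3.
    rewrite expRN -[leRHS]invrK lef_pV2 ?posrE ?expR_gt0 ?invr_gt0 ?divr_gt0 ?exprn_gt0//.
    have := @expR_ge1Dxn R x 2 (ltW x0).
    by rewrite invf_div (_ : 3`! = 6)%N//; lra.
  have xE : 6 * (`|a| + `|b| + `|c|) * x^-1 = (`|a| + `|b| + `|c|) * x ^+ 2 * (6 / x ^+ 3).
    by field; rewrite gt_eqF.
  rewrite mulNr -ler_norml xE normrM (ger0_norm (ltW e0)).
  apply: ler_pM => //.
  have x2 : 1 <= x ^+ 2 by rewrite exprn_ege1.
  have xx2 : x <= x ^+ 2 by rewrite expr2 ler_peMr// ltW.
  rewrite (le_trans (ler_normD _ _))// !mulrDl lerD//.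
    rewrite (le_trans (ler_normD _ _))// lerD//.
      by rewrite normrM (ger0_norm (sqr_ge0 x)).
    by rewrite normrM (ger0_norm (ltW x0)) ler_wpM2l.
  by rewrite ler_peMr.
- rewrite -(mulr0 (- (6 * (`|a| + `|b| + `|c|)))); apply: cvgM; first exact: cvg_cst.
  exact: cvgr_invy.
- rewrite -[X in _ --> X](mulr0 (6 * (`|a| + `|b| + `|c|))); apply: cvgM; first exact: cvg_cst.
  exact: cvgr_invy.
Unshelve. all: by end_near. Qed.

(** * Moments of the Laplace density *)

Section Laplace.
Context {R : realType} (s : R) (s0 : 0 < s).
Local Notation mu := (@lebesgue_measure R).

Lemma laplace_pdf_ge0 x : 0 <= laplace_pdf s x.
Proof. by rewrite mulr_ge0 ?expR_ge0// invr_ge0 mulr_ge0// ltW. Qed.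

Lemma laplace_pdfN x : laplace_pdf s (- x) = laplace_pdf s x.
Proof. by rewrite /laplace_pdf normrN. Qed.

Lemma continuous_laplace_pdf : continuous (laplace_pdf s).
Proof.
move=> x; apply: cvgM; first exact: cvg_cst.
apply: continuous_comp; last exact: continuous_expR.
apply: cvgM; last exact: cvg_cst.
by apply: cvgN; exact: norm_continuous.
Qed.

Lemma measurable_laplace_pdf : measurable_fun setT (laplace_pdf s).
Proof. by apply: continuous_measurable_fun; exact: continuous_laplace_pdf. Qed.

Lemma integral_laplace_pdf_sqr :
  (\int[mu]_x ((x ^+ 2)%:E * (laplace_pdf s x)%:E) = (2 * s ^+ 2)%:E)%E.
Proof.
have cf : continuous (fun x : R => x ^+ 2 * laplace_pdf s x).
  move=> x; apply: cvgM; last exact: continuous_laplace_pdf.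
  exact: exprn_continuous.
have f0 (x : R) : 0 <= x ^+ 2 * laplace_pdf s x.
  by rewrite mulr_ge0 ?sqr_ge0 ?laplace_pdf_ge0.
under eq_integral do rewrite -EFinM.
rewrite ge0_integralT_fold//.
under [X in (_ + X)%E]eq_integral do rewrite laplace_pdfN sqrrN.
(* Two integrations by parts yield this antiderivative on the nonnegative half-line. It runs from
   [- s ^+ 2] at 0 to the limit 0, so each half-line contributes [s ^+ 2]. *)
pose F (x : R) := - (2^-1 * x ^+ 2 + s * x + s ^+ 2) * expR (- (x / s)).
have dF (x : R) : is_derive x 1 F ((2 * s)^-1 * x ^+ 2 * expR (- (x / s))).
  rewrite /F; apply: is_derive_eq.
  rewrite /GRing.scale/=; field; exact: lt0r_neq0.
rewrite (@ge0_continuous_FTC2y _ _ F 0 0)//.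
- by rewrite /F expr0n/= !mulr0 mul0r oppr0 expR0 -EFinB -EFinD; congr EFin; ring.
- exact: continuous_subspaceT.
(* The coefficients are those of [F] rewritten in the variable [x / s]. *)
- have /(@cvg_comp _ _ _ (fun x => x / s) _ (pinfty_nbhs R) (pinfty_nbhs R)) :=
    @cvg_poly2_expRN R (- (2^-1 * s ^+ 2)) (- s ^+ 2) (- s ^+ 2).
  have H : x / s @[x --> +oo] --> +oo by apply: gt0_cvgMly => //; rewrite invr_gt0.
  move=> /(_ H); apply: cvg_trans; apply: near_eq_cvg; near=> x.
  by rewrite /F/=; congr (_ * _); field; exact: lt0r_neq0.
- by apply/cvg_at_right_filter/differentiable_continuous/derivable1_diffP.
- move=> x; rewrite in_itv/= andbT => x0.
  rewrite derive1E derive_val /laplace_pdf ger0_norm ?ltW// mulNr; ring.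
Unshelve. all: by end_near. Qed.

(** Since the density is even, reflection swaps the two half-line integrals. Keeping the integrands
    nonnegative postpones integrability; the zero mean follows once it is known. *)
Lemma integral_laplace_pdf_pos_neg :
  (\int[mu]_x ((Num.max x 0)%:E * (laplace_pdf s x)%:E) =
   \int[mu]_x ((Num.max (- x) 0)%:E * (laplace_pdf s x)%:E))%E.
Proof.
under eq_integral do rewrite -EFinM.
under [RHS]eq_integral do rewrite -EFinM.
rewrite !ge0_integralT_fold; first last.
- move=> x; apply: cvgM; last exact: continuous_laplace_pdf.
  by apply: continuous_max => //; exact: cvg_cst.
- by move=> x; rewrite mulr_ge0 ?laplace_pdf_ge0// le_max lexx orbT.
- move=> x; apply: cvgM; last exact: continuous_laplace_pdf.
  by apply: continuous_max => //; [exact: opp_continuous|exact: cvg_cst].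
- by move=> x; rewrite mulr_ge0 ?laplace_pdf_ge0// le_max lexx orbT.
rewrite addeC; congr (_ + _)%E; apply: eq_integral => x _; rewrite laplace_pdfN//.
by rewrite opprK.
Qed.

End Laplace.

(** * From independence to vanishing covariance *)

Section Independence.
Context {d} {Omega : measurableType d} {R : realType}
  (P : probability Omega R).

Lemma mutually_independentI {I : finType} {F : I -> set (set Omega)} {i j : I}
    {A B : set Omega} :
  mutually_independent P F -> i != j -> F i A -> F j B ->
  (P (A `&` B) = P A * P B)%E.
Proof.
move=> indF ij FA FB.
have := indF [set i; j]%SET (fun k => if k == i then A else B).
rewrite (big_setD1 i) ?inE ?eqxx//= (_ : [set i; j] :\ i = [set j])%SET; last first.
  by apply/setP => k; rewrite !inE; case: (eqVneq k i) => //= ->; rewrite (negbTE ij).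
rewrite big_set1 eq_sym (negbTE ij) => <-.
  congr (P _); apply/seteqP; split=> [w [Aw Bw] k _|w H].
    by case: ifP.
  split.
    by have /= := H i; rewrite eqxx; apply; rewrite !inE eqxx.
  have /= := H j; rewrite eq_sym (negbTE ij); apply; by rewrite !inE eqxx orbT.
by move=> k; rewrite !inE => /orP[|] /eqP ->; rewrite ?eqxx// eq_sym (negbTE ij).
Qed.

Lemma Lfun2_sqr (X : Omega -> R) : measurable_fun setT X ->
  ('E_P[X ^+ 2] < +oo)%E -> X \in Lfun P 2%:E.
Proof.
rewrite unlock => mX EX; rewrite inE/=; apply/andP; split; rewrite inE//=.
rewrite /finite_norm unlock poweR_lty//.
under eq_integral do rewrite /= powR_mulrn// -normrX ger0_norm ?sqr_ge0//.
exact: EX.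
Qed.

Lemma Lfun2_indic (A : set Omega) : measurable A ->
  (\1_A : Omega -> R) \in Lfun P 2%:E.
Proof.
move=> mA; apply: Lfun2_sqr => //.
rewrite (_ : \1_A ^+ 2 = \1_A :> (Omega -> R)); last first.
  by apply/funext => w; rewrite /= expr2 !fctE !indicE -natrM mulnb andbb.
by rewrite expectation_indic// (le_lt_trans (probability_le1 _ mA))// ltry.
Qed.

(* Idea: the pushforward of [P] restricted to [A] is [P A] times the law of [X]. *)
Lemma ge0_integral_indic_indep (A : set Omega) (X : {RV P >-> R})
    (f : R -> \bar R) :
  measurable A ->
  (forall B, measurable B -> P (A `&` X @^-1` B) = P A * P (X @^-1` B))%E ->
  measurable_fun [set: R] f -> (forall x, 0 <= f x)%E ->
  (\int[P]_w (f (X w) * (\1_A w)%:E) = P A * \int[P]_w f (X w))%E.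
Proof.
move=> mA indep mf f0.
have mX : measurable_fun setT X by [].
have mfX : measurable_fun setT (f \o X) by exact: measurableT_comp.
rewrite -(@ge0_integral_density _ _ _ P (mrestr P mA) (\1_A) (f \o X))//; last 2 first.
- by move=> B mB; rewrite integral_indic// /mrestr/= setIC.
- by move=> x; exact: f0.
rewrite -(@ge0_integral_pushforward _ _ _ _ _ _ mX (mrestr P mA) setT)//.
have PA0 : 0 <= fine (P A) by rewrite fine_ge0.
rewrite (eq_measure_integral (mscale (NngNum PA0) (distribution P X))); last first.
  move=> B mB _; rewrite /= /pushforward /mrestr /mscale/= fineK ?fin_num_measure//.
  by rewrite setIC indep.
by rewrite ge0_integral_mscale//= fineK ?fin_num_measure// ge0_integral_distribution.
Qed.

(** The product rule for nonnegative functions of [X] is applied to its positive and negative parts;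
    integrability of [X] allows the two to be subtracted. *)
Lemma covariance_indic_indep (A : set Omega) (X : {RV P >-> R}) :
  measurable A -> (X : Omega -> R) \in Lfun P 2%:E ->
  (forall B, measurable B -> P (A `&` X @^-1` B) = P A * P (X @^-1` B))%E ->
  covariance P (\1_A) X = 0%E.
Proof.
move=> mA X2 indep.
have Pfin : P setT \is a fin_num := fin_num_measure P _ measurableT.
have A2 := Lfun2_indic A mA.
have X1 := Lfun_subset12 Pfin X2.
rewrite covarianceE ?Lfun2_mul_Lfun1 ?(Lfun_subset12 Pfin)//.
rewrite expectation_indic// (_ : 'E_P[_] = P A * 'E_P[X])%E; last first.
  have iX : P.-integrable setT (EFin \o X) by exact/Lfun1_integrable.
  rewrite unlock integralE [in RHS]integralE muleBr ?fin_num_measure//; last first.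
    rewrite fin_num_adde_defl// fin_numN.
    by apply: integrable_neg_fin_num.
  have gp : (\int[P]_x (EFin \o X)^\+ x = \int[P]_x ((@EFin R)^\+ (X x)))%E.
    by apply: eq_integral => x _; rewrite !funeposE.
  have gn : (\int[P]_x (EFin \o X)^\- x = \int[P]_x ((@EFin R)^\- (X x)))%E.
    by apply: eq_integral => x _; rewrite !funenegE.
  have mE : measurable_fun [set: R] (@EFin R) by exact/measurable_EFinP.
  rewrite gp gn -(ge0_integral_indic_indep A X)//; last exact: measurable_funepos.
  rewrite -(ge0_integral_indic_indep A X)//; last exact: measurable_funeneg.
  (* An indicator takes only the values 0 and 1, so it commutes with positive and negative parts. *)
  congr (_ - _)%E; apply: eq_integral => w _; rewrite ?funeposE ?funenegE !fctE indicE.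
    by case: (w \in A); rewrite ?mul1r ?mul0r ?mule1 ?mule0// maxxx.
  by case: (w \in A); rewrite ?mul1r ?mul0r ?mule1 ?mule0// oppe0 maxxx.
by rewrite subee// fin_numM ?fin_num_measure ?expectation_fin_num.
Qed.

Lemma covariance_sumr {I : Type} (s : seq I) (X : Omega -> R) (Y : I -> Omega -> R) :
  X \in Lfun P 2%:E -> (forall i, Y i \in Lfun P 2%:E) ->
  covariance P X (\sum_(i <- s) Y i) = (\sum_(i <- s) covariance P X (Y i))%E.
Proof.
move=> X2 Y2; elim: s => [|i s IH]; first by rewrite !big_nil covariance_cst_r.
by rewrite !big_cons covarianceDr ?IH// rpred_sum// lee1n.
Qed.

Lemma variance_sum_uncorrelated {I : eqType} (s : seq I) (X : I -> Omega -> R) :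
  uniq s -> (forall i, X i \in Lfun P 2%:E) ->
  (forall i j, i != j -> covariance P (X i) (X j) = 0%E) ->
  variance P (\sum_(i <- s) X i) = (\sum_(i <- s) variance P (X i))%E.
Proof.
move=> + X2 cov0; elim: s => [_|i s IH /= /andP[si us]].
  by rewrite !big_nil variance_cst.
rewrite !big_cons varianceD ?IH//; last by rewrite rpred_sum// lee1n.
(* The cross term is a sum of covariances of the head with tail elements, all distinct from the head
   by [uniq]. *)
rewrite covariance_sumr// [X in (2%:E * X)%E]big_seq [X in (2%:E * X)%E]big1.
  by rewrite mule0 adde0.
by move=> j js; apply: cov0; apply: contraNneq si => ->.
Qed.

End Independence.

(** * Which random bit each sampled user ends up with *)

Section LastUpdate.
Context {U : finType} {m T : nat} (M : m.-tuple U) (S : T.-tuple U).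

(* The last update wins, so the value of [i] on a prefix of the stream is a left
   fold over the prefix; [inl i] stands for the initial bit. *)
Definition bit_source (i : 'I_m) : 'I_m + 'I_T :=
  foldl (fun k t => if tnth S t == tnth M i then inr t else k) (inl i)
    (enum 'I_T).

Lemma obde_bits_source (b0 : 'I_m -> bool) (r : 'I_T -> bool) (i : 'I_m) :
  obde_bits M S b0 r i =
  match bit_source i with inl j => b0 j | inr t => r t end.
Proof.
rewrite /obde_bits /bit_source.
elim/last_ind: (enum _) => [|s t IH]; first by rewrite ffunE.
rewrite map_rcons -!cats1 !foldl_cat/= ffunE/= IH.
by case: eqP.
Qed.

Lemma bit_sourceP (i : 'I_m) :
  match bit_source i with
  | inl j => j = i /\ tnth M i \notin S
  | inr t => tnth S t = tnth M i
  end.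
Proof.
(* Absence from the whole stream is not inductive; absence from the prefix read so far is. *)
have : match bit_source i with
  | inl j => j = i /\ {in enum 'I_T, forall t, tnth S t != tnth M i}
  | inr t => tnth S t = tnth M i
  end.
  rewrite /bit_source; elim/last_ind: (enum _) => [|s t IH]//=.
  rewrite -!cats1 !foldl_cat/=; case: eqP => // /eqP Mt.
  move: IH; case: foldl => // j [-> H]; split=> // t'.
  by rewrite mem_cat inE => /orP[/H//|/eqP ->].
case: (bit_source i) => // j [-> H]; split=> //.
by apply/negP => /tnthP[t Mt]; move: (H t); rewrite mem_enum Mt eqxx => /(_ isT).
Qed.

(** A source determines its user: an initial bit carries the index, and a fresh bit belongs to an
    update naming the user. *)
Lemma bit_source_inj : uniq M -> injective bit_source.
Proof.
move=> uM i j ij; move: (bit_sourceP i) (bit_sourceP j); rewrite ij.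
case: bit_source => [k [-> _] [-> _]//|t -> tM]; exact: (tuple_uniqP M uM).
Qed.

Lemma density_sum {R : realType} : uniq M ->
  density R M S = m%:R^-1 * \sum_(i < m) (tnth M i \in S)%:R.
Proof.
move=> uM; rewrite /density mulrC; congr (_^-1 * _).
  by rewrite cardsE (card_uniqP uM) size_tuple.
rewrite -natr_sum; congr (_%:R).
rewrite (_ : [set u in M | u \in substream M S]%SET =
             [set tnth M i | i : 'I_m & tnth M i \in S]%SET).
  rewrite card_imset; last exact/tuple_uniqP.
  by rewrite -sum1dep_card -big_mkcond.
apply/setP => u; rewrite !inE mem_filter; apply/andP/imsetP.
  by move=> [/tnthP[i ->] /andP[_ ?]]; exists i; rewrite ?inE.
by move=> [i] /[!inE] iS ->; rewrite mem_tnth.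
Qed.

End LastUpdate.

(** * Mean and variance of the noise *)

Section LaplaceNoise.
Context {d} {Omega : measurableType d} {R : realType}
  (P : probability Omega R) (Z : {RV P >-> R}) (s : R).
Hypothesis s0 : 0 < s.
Hypothesis ZE : forall A : set R, measurable A ->
  distribution P Z A =
  (\int[lebesgue_measure]_(x in A) (laplace_pdf s x)%:E)%E.

Lemma ge0_expectation_laplace (f : R -> \bar R) :
  measurable_fun [set: R] f -> (forall x, 0 <= f x)%E ->
  (\int[P]_w f (Z w) =
   \int[lebesgue_measure]_x (f x * (laplace_pdf s x)%:E))%E.
Proof.
move=> mf f0.
have mZ : measurable_fun setT (Z : Omega -> measurableTypeR R) := measurable_funPT Z.
(* [lebesgue_measure] lives on [measurableTypeR R], whose sigma-algebra is the
   canonical one of [R] but whose display differs. *)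
pose Z' : {mfun Omega >-> measurableTypeR R} :=
  HB.pack (Z : Omega -> measurableTypeR R) (isMeasurableFun.Build _ _ _ _ _ mZ).
rewrite -[LHS](ge0_integral_distribution Z' (f := f))//.
apply: (ge0_integral_density lebesgue_measure (distribution P Z')) => //.
  exact: measurable_laplace_pdf.
exact: laplace_pdf_ge0.
Qed.

Lemma expectation_laplace_sqr : ('E_P[Z ^+ 2] = (2 * s ^+ 2)%:E)%E.
Proof.
rewrite unlock -integral_laplace_pdf_sqr//.
rewrite -(ge0_expectation_laplace (fun x : R => (x ^+ 2)%:E))//.
- by apply/measurable_EFinP; exact: measurable_funX.
- by move=> x; rewrite lee_fin sqr_ge0.
Qed.

Lemma Lfun2_laplace : (Z : Omega -> R) \in Lfun P 2%:E.
Proof. by apply: Lfun2_sqr => //; rewrite expectation_laplace_sqr ltry. Qed.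

(** The finite second moment makes [Z] integrable, so its positive and negative parts have finite
    integrals, which agree by symmetry and cancel. *)
Lemma expectation_laplace : ('E_P[Z] = 0)%E.
Proof.
have iZ : P.-integrable setT (EFin \o Z).
  apply/Lfun1_integrable; apply: Lfun_subset12 Lfun2_laplace.
  exact: fin_num_measure.
have mE : measurable_fun [set: R] (@EFin R) by exact/measurable_EFinP.
have Ep : (\int[P]_w (EFin \o Z)^\+ w =
    \int[lebesgue_measure]_x ((Num.max x 0)%:E * (laplace_pdf s x)%:E))%E.
  rewrite -(ge0_expectation_laplace (fun x => (Num.max x 0)%:E)).
  - by apply: eq_integral => w _; rewrite funeposE/= EFin_max.
  - by apply/measurable_EFinP; exact: measurable_maxr.
  - by move=> x; rewrite lee_fin le_max lexx orbT.
have En : (\int[P]_w (EFin \o Z)^\- w =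
    \int[lebesgue_measure]_x ((Num.max (- x) 0)%:E * (laplace_pdf s x)%:E))%E.
  rewrite -(ge0_expectation_laplace (fun x => (Num.max (- x) 0)%:E)).
  - by apply: eq_integral => w _; rewrite funenegE/= EFin_max.
  - by apply/measurable_EFinP; exact: measurable_maxr.
  - by move=> x; rewrite lee_fin le_max lexx orbT.
rewrite unlock integralE -[X in (X - _)%E]/(\int[P]_w (EFin \o Z)^\+ w)%E.
rewrite -[X in (_ - X)%E]/(\int[P]_w (EFin \o Z)^\- w)%E.
rewrite Ep En -integral_laplace_pdf_pos_neg// -Ep subee//.
exact: integrable_pos_fin_num.
Qed.

Lemma variance_laplace : ('V_P[Z] = (2 * s ^+ 2)%:E)%E.
Proof.
rewrite varianceE ?Lfun2_laplace// expectation_laplace_sqr expectation_laplace.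
by rewrite expe2 mule0 sube0.
Qed.

End LaplaceNoise.

(** * Bias and mean squared error of the estimator *)

Lemma bernoulli_prob_true {R : realType} (p : R) :
  0 <= p <= 1 -> bernoulli_prob p [set true] = p%:E.
Proof.
move=> p01; rewrite bernoulli_probE// !diracE mem_set// memNset//.
by rewrite mule1 mule0 adde0.
Qed.

(** These bounds keep both Bernoulli parameters in the unit interval and make division by [tanh]
    legitimate. *)
Lemma tanh_gt0_lt1 {R : realType} (x : R) : 0 < x -> 0 < tanh x < 1.
Proof.
move=> x0; have e1 := expR_gt0 x; have e2 := expR_gt0 (- x).
have e12 : expR (- x) < expR x by rewrite ltr_expR; lra.
by rewrite divr_gt0 ?ltr_pdivrMr/=; lra.
Qed.

Theorem theorem4p5 (R : realType) (U : finType) (eps : R)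
    (heps : 0 < eps <= 1 / 2) (m : nat) (hm : (0 < m)%N)
    (T : nat) (S : T.-tuple U) (M : m.-tuple U) (hM : uniq M)
    (d : measure_display) (Omega : measurableType d)
    (P : probability Omega R) (W : obde_randomness P eps m T) :
  ('E_P[obde M S W] = (density R M S)%:E)%E /\
  ('E_P[(fun w => (obde M S W w - density R M S) ^+ 2)%R]
     <= (1 / (4 * m%:R * tanh (eps / 2) ^+ 2)
         + 2 / (m%:R ^+ 2 * eps ^+ 2))%R%:E)%E.
Proof.
set tau := tanh (eps / 2).
have /andP[eps0 _] := heps.
have /andP[tau0 tau1] : 0 < tau < 1 by apply: tanh_gt0_lt1; rewrite divr_gt0.
have m0 : 0 < m%:R :> R by rewrite ltr0n.
have s0 : 0 < 1 / (eps * m%:R) by rewrite divr_gt0// mulr_gt0.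
(* Initial and fresh bits form one family indexed by the possible values of [bit_source]. *)
pose bit k : {RV P >-> bool} :=
  match k with inl j => init_bit W j | inr t => fresh_bit W t end.
pose p (k : 'I_m + 'I_T) : R :=
  if k is inl _ then 1 / 2 * (1 - tau) else 1 / 2 * (1 + tau).
pose A k := bit k @^-1` [set true].
pose Z := noise W.
have mA k : measurable (A k) by rewrite /A -[X in measurable X]setTI; exact: measurable_funPT.
have PA k : P (A k) = (p k)%:E.
  case: k => k.
    rewrite -[LHS]/(distribution P (init_bit W k) [set true]).
    by rewrite init_bit_law bernoulli_prob_true//; apply/andP; split; rewrite -/tau; lra.
  rewrite -[LHS]/(distribution P (fresh_bit W k) [set true]).
  by rewrite fresh_bit_law bernoulli_prob_true//; apply/andP; split; rewrite -/tau; lra.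
have FA k : (match k with
    | inl j => g_sigma_algebra_preimage (init_bit W j)
    | inr t => g_sigma_algebra_preimage (fresh_bit W t) end) (A k).
  by case: k => k; exists [set true] => //; rewrite setTI.
have indep := @obde_independence _ _ _ _ _ _ _ W.
have AA k l : k != l -> (P (A k `&` A l) = P (A k) * P (A l))%E.
  move=> kl; have ij : (inl k : 'I_m + 'I_T + unit) != inl l.
    by rewrite (inj_eq inl_inj).
  apply: (mutually_independentI P indep ij).
  - by move: (FA k); case: (k).
  - by move: (FA l); case: (l).
have AZ k B : measurable B -> (P (A k `&` Z @^-1` B) = P (A k) * P (Z @^-1` B))%E.
  move=> mB; have ij : (inl k : 'I_m + 'I_T + unit) != inr tt by [].
  apply: (mutually_independentI P indep ij).
  - by move: (FA k); case: (k).
  - by exists B => //; rewrite setTI.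
have Pfin : P setT \is a fin_num := fin_num_measure P _ measurableT.
have L21 := Lfun_subset12 Pfin.
pose X k : Omega -> R := \1_(A k).
have X2 k : X k \in Lfun P 2%:E by exact: Lfun2_indic.
have X1 k : X k \in Lfun P 1 by exact: L21.
have XX1 k l : X k * X l \in Lfun P 1 by exact: Lfun2_mul_Lfun1.
have EX k : ('E_P[X k] = (p k)%:E)%E by rewrite expectation_indic.
have VX k : ('V_P[X k] <= (1 / 4)%:E)%E.
  rewrite varianceE// EX (_ : X k ^+ 2 = X k); last first.
    by apply/funext => w; rewrite /X expr2 !fctE !indicE -natrM mulnb andbb.
  rewrite EX -EFin_expe -EFinB lee_fin.
  (* The variance [p k - p k ^+ 2] equals [1 / 4] minus this square. *)
  have := sqr_ge0 (p k - 1 / 2); rewrite !expr2; lra.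
have covX k l : k != l -> covariance P (X k) (X l) = 0%E.
  move=> kl; rewrite covarianceE// !EX.
  rewrite (_ : X k * X l = \1_(A k `&` A l)); last by rewrite indicI.
  by rewrite expectation_indic ?AA ?PA ?subee//; exact: measurableI.
have Z2 : (Z : Omega -> R) \in Lfun P 2%:E := Lfun2_laplace P Z _ s0 (noise_law W).
have covXZ k : covariance P (X k) Z = 0%E.
  by apply: covariance_indic_indep => //; exact: AZ.
pose src := bit_source M S.
have src_inj : injective src by exact: bit_source_inj.
(* [a] is the weight of one bit after debiasing, and [b] below is the constant shift. *)
pose a : R := tau^-1 * m%:R^-1.
pose Y (i : 'I_m) : Omega -> R := a \o* X (src i).
pose b : R := tau^-1 * (- (1 / 2) + 1 / 2 * tau).
have Y2 i : Y i \in Lfun P 2%:E by rewrite Lfun_scale ?ler1n.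
have Y1 i : Y i \in Lfun P 1 by exact: L21.
have XY1 k i : X k * Y i \in Lfun P 1 by exact: Lfun2_mul_Lfun1.
have Z1 := L21 _ Z2.
have sY2 : \sum_(i < m) Y i \in Lfun P 2%:E by rewrite rpred_sum ?lee1n.
have obdeE : obde M S W = ((\sum_(i < m) Y i) \+ Z) \+ cst b.
  apply/funext => w; rewrite /obde /obde_output /= -/Z fct_sumE -/tau.
  rewrite (_ : \sum_(i < m) Y i w = a * \sum_(i < m) (obde_bits M S
    (fun i0 : 'I_m => init_bit W i0 w) (fun t => fresh_bit W t w) i)%:R).
    by rewrite /a /b; ring.
  rewrite mulr_sumr; apply: eq_bigr => i _.
  rewrite obde_bits_source -/src /Y /= mulrC /X indicE.
  have -> : (w \in A (src i)) = bit (src i) w by apply/idP/idP; rewrite inE.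
  by case: (src i).
have EY : ('E_P[\sum_(i < m) Y i] = (\sum_(i < m) a * p (src i))%:E)%E.
  rewrite -(big_map Y xpredT id) expectation_sum; last first.
    by move=> _ /mapP[i _ ->]; exact: L21.
  rewrite big_map -sumEFin; apply: eq_bigr => i _.
  by rewrite expectationZl// EX EFinM.
have ED : ('E_P[obde M S W] = (density R M S)%:E)%E.
  rewrite obdeE !expectationD ?Lfun_cst ?rpredD ?L21//.
  rewrite expectation_cst EY (expectation_laplace P Z _ s0 (noise_law W)) adde0.
  rewrite -EFinD density_sum//; congr EFin.
  (* The mean of a final bit is affine in the presence indicator; [a] and [b] invert this map on the
     average. *)
  have pE i : p (src i) = 1 / 2 * (1 - tau) + tau * (tnth M i \in S)%:R.
    move: (bit_sourceP M S i); rewrite -/src; case: (src i) => [j [_ /negbTE ->]|t <-] /=.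
      by rewrite mulr0 addr0.
    by rewrite mem_tnth (_ : true%:R = 1)//; lra.
  rewrite -mulr_sumr (eq_bigr _ (fun i _ => pE i)) big_split/= -!mulr_sumr.
  rewrite sumr_const card_ord -mulr_natl /a /b; field.
  by rewrite !gt_eqF.
split=> //.
have -> : ('E_P[(fun w => (obde M S W w - density R M S) ^+ 2)%R] =
    'V_P[obde M S W])%E.
  by rewrite /variance [in RHS]unlock ED/=; congr expectation;
    apply/funext => w; rewrite /= expr2.
rewrite obdeE varianceD_cst_r ?rpredD ?lee1n// varianceD//.
rewrite (covarianceC P _ Z) covariance_sumr// [X in (2%:E * X)%E]big1
  ?mule0 ?adde0; last first.
  move=> i _; rewrite /Y covarianceZr// ?Lfun2_mul_Lfun1//.
  by rewrite covarianceC covXZ mule0.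
rewrite (variance_laplace P Z _ s0 (noise_law W)) variance_sum_uncorrelated//; last 2 first.
- exact: index_enum_uniq.
- move=> i j ij; rewrite (covarianceZl a (X1 (src i)) (Y1 j) (XY1 _ j)) covarianceZr//.
  by rewrite covX ?mule0// (inj_eq src_inj).
apply: (@le_trans _ _ (\sum_(i < m) (a ^+ 2 * (1 / 4))%:E +
  (2 * (1 / (eps * m%:R)) ^+ 2)%:E)%E).
  rewrite leeD2r//; apply: lee_sum => i _.
  by rewrite /Y varianceZ// (EFinM (a ^+ 2)) lee_wpmul2l// lee_fin sqr_ge0.
rewrite sumEFin -EFinD lee_fin sumr_const card_ord -mulr_natl /a.
(* The two sides are equal: [m] terms [a ^+ 2 / 4] sum to the first fraction, and the noise variance
   is the second. *)
rewrite le_eqVlt; apply/orP; left; apply/eqP; field.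
by rewrite !gt_eqF.
Qed.
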